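(* Let $g(\hat x)=C\hat x-c$ be a linear constraint function. Then the update $\hat x^*$, i.e. the solution of $$\min_{\hat x\in\mathbb{R}^n}\ \sum_{i\in I}\lambda_i^T(\hat x-z_i)+\frac{\rho}{2}\sum_{i\in I}\|\hat x-z_i\|^2\quad\text{s.t.}\quad g(\hat x)=0,$$ is given by $$\hat x^*=C^\dagger c+UU^\dagger(d-C^\dagger c),$$ where $d=\frac1s\sum_{i\in I}\left(z_i-\frac1\rho\lambda_i\right)$ and $U=I_{n\times n}-C^\dagger C$ is the orthogonal projection matrix onto the nullspace $\mathcal N(C)$ of $C$.
   Context: Here $I=\{1,\dots,s\}$ is the index set, $z_i,\lambda_i\in\mathbb{R}^n$ ($i\in I$) are given vectors, $\rho>0$ is a given penalty parameter, $C$ is a real matrix with $n$ columns and $c$ is a vector of compatible dimension. $A^\dagger$ denotes the Moore–Penrose generalized inverse of a matrix $A$, and $I_{n\times n}$ the identity matrix. The norm is Euclidean. *)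

(* Defs.v *)
From mathcomp Require Import all_boot all_order all_algebra.
From mathcomp Require Import reals.

Set Implicit Arguments.
Unset Strict Implicit.
Unset Printing Implicit Defensive.

Import Order.TTheory GRing.Theory Num.Theory.
Local Open Scope ring_scope.

Section MoorePenrose.
Variable R : realType.

(* The four Penrose equations. MathComp's [pinvmx] is only some generalized
   inverse: it need not satisfy the two symmetry equations. *)
Definition penrose (m n : nat) (A : 'M[R]_(m, n)) (X : 'M[R]_(n, m)) : bool :=
  [&& A *m X *m A == A, X *m A *m X == X,
      (A *m X)^T == A *m X & (X *m A)^T == X *m A].

Lemma mulmx_tr_eq0 (n : nat) (w : 'rV[R]_n) : w *m w^T = 0 -> w = 0.
Proof.
move=> /matrixP /(_ 0 0); rewrite !mxE => w0.
have {w0}/eqP : \sum_j w 0 j ^+ 2 = 0.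
  by rewrite -[RHS]w0; apply: eq_bigr => j _; rewrite mxE expr2.
rewrite psumr_eq0 => [/allP w0|j _]; last exact: sqr_ge0.
apply/rowP => j; rewrite mxE; apply/eqP.
by have := w0 j (mem_index_enum j); rewrite sqrf_eq0.
Qed.

Lemma gram_unitmx (m n : nat) (B : 'M[R]_(m, n)) :
  row_free B -> B *m B^T \in unitmx.
Proof.
move=> Bfree; rewrite -row_free_unit; apply: inj_row_free => v vBB0.
have /mulmx_tr_eq0 vB0 : (v *m B) *m (v *m B)^T = 0.
  by rewrite trmx_mul mulmxA -(mulmxA v) vBB0 mul0mx.
by apply: (row_free_inj Bfree); rewrite vB0 mul0mx.
Qed.

Lemma full_rank_penrose (m n r : nat) (G : 'M[R]_(m, r)) (F : 'M[R]_(r, n)) :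
  row_free F -> row_free G^T ->
  penrose (G *m F)
    (F^T *m invmx (F *m F^T) *m (invmx (G^T *m G) *m G^T)).
Proof.
move=> Ff Gf; have Fu := gram_unitmx Ff.
have := gram_unitmx Gf; rewrite trmxK => Gu.
have sF : (invmx (F *m F^T))^T = invmx (F *m F^T).
  by rewrite trmx_inv trmx_mul trmxK.
have sG : (invmx (G^T *m G))^T = invmx (G^T *m G).
  by rewrite trmx_inv trmx_mul trmxK.
set P := F^T *m _; set Q := _ *m G^T.
have FP : F *m P = 1%:M by rewrite mulmxA mulmxV.
have QG : Q *m G = 1%:M by rewrite -mulmxA mulVmx.
have AX : G *m F *m (P *m Q) = G *m Q.
  by rewrite -mulmxA (mulmxA F) FP mul1mx.
have XA : P *m Q *m (G *m F) = P *m F.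
  by rewrite -mulmxA (mulmxA Q) QG mul1mx.
apply/and4P; split; apply/eqP.
- by rewrite AX -mulmxA (mulmxA Q) QG mul1mx.
- by rewrite XA -mulmxA (mulmxA F) FP mul1mx.
- by rewrite AX !trmx_mul trmxK sG mulmxA.
- by rewrite XA !trmx_mul trmxK sF mulmxA.
Qed.

Lemma penrose_exists (m n : nat) (A : 'M[R]_(m, n)) : exists X, penrose A X.
Proof.
have /full_rank_penrose H := row_base_free A.
have := H _ (col_base A); rewrite mulmx_base => {}H.
by eexists; apply: H; rewrite /row_free mxrank_tr; exact: col_base_full.
Qed.

Definition mpinv (m n : nat) (A : 'M[R]_(m, n)) : 'M[R]_(n, m) :=
  xchoose (penrose_exists A).

Lemma mpinvP (m n : nat) (A : 'M[R]_(m, n)) : penrose A (mpinv A).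
Proof. exact: xchooseP. Qed.

Lemma penrose_unique (m n : nat) (A : 'M[R]_(m, n)) (X Y : 'M[R]_(n, m)) :
  penrose A X -> penrose A Y -> X = Y.
Proof.
case/and4P=> /eqP X1 /eqP X2 /eqP X3 /eqP X4.
case/and4P=> /eqP Y1 /eqP Y2 /eqP Y3 /eqP Y4.
have AXY : A *m X = A *m Y.
  rewrite -X3 -{1}Y1 -mulmxA trmx_mul X3 Y3 mulmxA.
  by rewrite X1.
have XAY : X *m A = Y *m A.
  rewrite -X4 -{1}Y1 -mulmxA mulmxA trmx_mul Y4 X4.
  by rewrite -mulmxA (mulmxA A) X1.
by rewrite -X2 -mulmxA AXY mulmxA XAY Y2.
Qed.

End MoorePenrose.

Section Optimization.
Variable R : realType.

(* Not the generic norm [`|v|] on matrices, which is the sup norm. *)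
Definition enorm (n : nat) (v : 'cV[R]_n) : R :=
  Num.sqrt (\sum_(i < n) v i 0 ^+ 2).

Definition dot (n : nat) (u v : 'cV[R]_n) : R := (u^T *m v) 0 0.

Definition is_solution (m n : nat) (f : 'cV[R]_n -> R)
    (g : 'cV[R]_n -> 'cV[R]_m) (x : 'cV[R]_n) : Prop :=
  g x = 0 /\ forall y : 'cV[R]_n, g y = 0 -> f x <= f y.

Definition objective (n s : nat) (z lambda : 'I_s -> 'cV[R]_n) (rho : R)
    (x : 'cV[R]_n) : R :=
  \sum_(i < s) dot (lambda i) (x - z i)
  + rho / 2 * \sum_(i < s) enorm (x - z i) ^+ 2.

Definition lin_constraint (m n : nat) (C : 'M[R]_(m, n)) (c : 'cV[R]_m)
    (x : 'cV[R]_n) : 'cV[R]_m := C *m x - c.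

(* Stated with column vectors, hence not through MathComp's [kermx], which is
   the kernel for the action on row vectors. *)
Definition nullspace (m n : nat) (C : 'M[R]_(m, n)) (x : 'cV[R]_n) : Prop :=
  C *m x = 0.

Definition is_orthogonal_projection (n : nat) (P : 'M[R]_n)
    (S : 'cV[R]_n -> Prop) : Prop :=
  forall x : 'cV[R]_n,
    S (P *m x) /\ forall y : 'cV[R]_n, S y -> dot y (x - P *m x) = 0.

End Optimization.

(* Main.v *)
Require Import Defs.
From mathcomp Require Import all_boot all_order all_algebra.
From mathcomp Require Import reals.
From mathcomp Require Import ring.

Set Implicit Arguments.
Unset Strict Implicit.
Unset Printing Implicit Defensive.

Import Order.TTheory GRing.Theory Num.Theory.
Local Open Scope ring_scope.

(** Since the quadratic terms all have the same isotropic Hessian, completing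
    the square turns the objective into a constant plus
    [rho / 2 * s] times the squared distance to [d] ([objective_square]).  The
    problem therefore asks for the point of the affine set [C x = c] nearest
    to [d], whose solution is unique by Pythagoras
    ([nearest_point_unique]): it is the feasible point [x0] for which [x0 - d]
    is orthogonal to the nullspace of [C].

    To recognise that point in the closed formula, note that the Penrose
    equations make [U = 1 - C^+ C] a symmetric idempotent, so that [U] is its
    own pseudoinverse and [U U^+ = U].  The formula thus reads
    [x0 = C^+ c + U (d - C^+ c)]: it is feasible because [C C^+ c = c] as soon
    as [c] is in the range of [C], and [d - x0] is the component
    [v - U v] of [v = d - C^+ c], orthogonal to the nullspace because [U] is
    the orthogonal projection onto it. *)

(** * The Euclidean inner product *)

Section Dot.
Variables (R : realType) (n : nat).
Implicit Types u v w : 'cV[R]_n.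

Lemma dotC u v : dot u v = dot v u.
Proof. by rewrite /dot -[in LHS](trmxK v) -trmx_mul mxE. Qed.

Lemma dotDl u v w : dot (u + v) w = dot u w + dot v w.
Proof. by rewrite /dot linearD mulmxDl mxE. Qed.

Lemma dotZl a u w : dot (a *: u) w = a * dot u w.
Proof. by rewrite /dot linearZ -scalemxAl mxE. Qed.

Lemma dotNl u w : dot (- u) w = - dot u w.
Proof. by rewrite -scaleN1r dotZl mulN1r. Qed.

Lemma dotDr u v w : dot w (u + v) = dot w u + dot w v.
Proof. by rewrite dotC dotDl !(dotC w). Qed.

Lemma dotNr u w : dot w (- u) = - dot w u.
Proof. by rewrite dotC dotNl dotC. Qed.

Lemma dot0l w : dot 0 w = 0.
Proof. by rewrite -(scale0r w) dotZl mul0r. Qed.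

Lemma dot_suml (s : nat) (F : 'I_s -> 'cV[R]_n) w :
  dot (\sum_i F i) w = \sum_i dot (F i) w.
Proof.
by apply: (big_morph (fun u => dot u w)) => [u v|]; rewrite ?dotDl ?dot0l.
Qed.

Lemma dot_sqr u : dot u u = \sum_i u i 0 ^+ 2.
Proof. by rewrite /dot mxE; apply: eq_bigr => i _; rewrite mxE expr2. Qed.

Lemma dot_ge0 u : 0 <= dot u u.
Proof. by rewrite dot_sqr sumr_ge0 // => i _; exact: sqr_ge0. Qed.

Lemma dot_eq0 u : dot u u = 0 -> u = 0.
Proof.
move=> u0; apply: trmx_inj; rewrite trmx0; apply: mulmx_tr_eq0.
by apply/matrixP => i j; rewrite !ord1 trmxK -[LHS]/(dot u u) u0 mxE.
Qed.

Lemma enorm_sqr u : enorm u ^+ 2 = dot u u.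
Proof. by rewrite /enorm -dot_sqr sqr_sqrtr // dot_ge0. Qed.

Lemma dot_mulmxl (A : 'M[R]_n) u v : dot (A *m u) v = dot u (A^T *m v).
Proof. by rewrite /dot trmx_mul mulmxA. Qed.

End Dot.

(** * Reduction to a nearest-point problem *)

(** The shifted point [d] is the critical point of the objective, that is,
    the gradients of the summands cancel there; no first-order term is left
    in the expansion around [d]. *)
Lemma objective_square (R : realType) (n s : nat)
    (z lambda : 'I_s -> 'cV[R]_n) (rho : R) (x : 'cV[R]_n) :
  (0 < s)%N -> 0 < rho ->
  let d := s%:R^-1 *: \sum_(i < s) (z i - rho^-1 *: lambda i) in
  objective z lambda rho x =
    objective z lambda rho d + rho / 2 * s%:R * dot (x - d) (x - d).
Proof.
move=> s_gt0 rho_gt0 d.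
have s0 : s%:R != 0 :> R by rewrite pnatr_eq0 -lt0n.
have rho0 : rho != 0 by rewrite gt_eqF.
have grad0 : \sum_(i < s) (lambda i + rho *: (d - z i)) = 0.
  have -> : \sum_(i < s) (lambda i + rho *: (d - z i)) =
      rho *: (\sum_(i < s) d - \sum_(i < s) (z i - rho^-1 *: lambda i)).
    rewrite -sumrB scaler_sumr; apply: eq_bigr => i _.
    by rewrite opprB [in RHS]addrCA [in RHS]scalerDr scalerA mulfV // scale1r.
  rewrite sumr_const card_ord -scaler_nat /d scalerA mulfV // scale1r.
  by rewrite subrr scaler0.
clearbody d.
have expand i : dot (lambda i) (x - z i) + rho / 2 * dot (x - z i) (x - z i) =
    dot (lambda i) (d - z i) + rho / 2 * dot (d - z i) (d - z i)
    + dot (lambda i + rho *: (d - z i)) (x - d)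
    + rho / 2 * dot (x - d) (x - d).
  rewrite !(dotDl, dotDr, dotNl, dotNr, dotZl).
  rewrite (dotC (z i) x) (dotC (z i) d) (dotC d x).
  by field.
have sumE y : objective z lambda rho y =
    \sum_(i < s) (dot (lambda i) (y - z i)
                  + rho / 2 * dot (y - z i) (y - z i)).
  rewrite /objective mulr_sumr -big_split /=.
  by apply: eq_bigr => i _; rewrite enorm_sqr.
rewrite !sumE (eq_bigr _ (fun i _ => expand i)) !big_split /=.
rewrite -dot_suml grad0 dot0l addr0 sumr_const card_ord -[_ *+ s]mulr_natr.
by rewrite mulrAC.
Qed.

(** By Pythagoras, moving inside the feasible set away from [x] adds
    [k * dot (y - x) (y - x)] to the cost, which is positive unless [y = x]. *)
Lemma nearest_point_unique (R : realType) (m n : nat)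
    (f : 'cV[R]_n -> R) (g : 'cV[R]_n -> 'cV[R]_m) (b k : R)
    (d x y : 'cV[R]_n) :
  0 < k -> (forall v, f v = b + k * dot (v - d) (v - d)) ->
  g x = 0 -> (forall v, g v = 0 -> dot (v - x) (d - x) = 0) ->
  is_solution f g y <-> y = x.
Proof.
move=> k_gt0 fE gx orth.
have pyth v : g v = 0 -> f v = f x + k * dot (v - x) (v - x).
  move=> /orth vx0; rewrite !fE.
  have -> : v - d = (v - x) - (d - x) by rewrite opprB addrA subrK.
  rewrite -(opprB d x) !(dotDl (v - x), dotDr (v - x)) (dotC _ (v - x)).
  by rewrite !(dotNl, dotNr) vx0; ring.
split=> [[gy ymin]|->].
  apply/subr0_eq/dot_eq0/eqP; rewrite eq_le dot_ge0 andbT.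
  by rewrite -(pmulr_rle0 _ k_gt0) -(gerDl (f x)) -pyth // ymin.
split=> // v gv; rewrite (pyth v gv) lerDl.
by rewrite mulr_ge0 ?dot_ge0 // ltW.
Qed.

(** * The projection attached to the pseudoinverse *)

Section NullProjection.
Variables (R : realType) (m n : nat) (C : 'M[R]_(m, n)).
Let U : 'M[R]_n := 1%:M - mpinv C *m C.

Lemma tr_null_proj : U^T = U.
Proof.
by have /and4P[_ _ _ /eqP CC] := mpinvP C; rewrite linearB /= trmx1 CC.
Qed.

Lemma mulmx_null_proj : C *m U = 0.
Proof.
have /and4P[/eqP CC _ _ _] := mpinvP C.
by rewrite mulmxBr mulmx1 mulmxA CC subrr.
Qed.

Lemma null_proj_id p (Y : 'M[R]_(n, p)) : C *m Y = 0 -> U *m Y = Y.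
Proof. by move=> CY0; rewrite mulmxBl mul1mx -mulmxA CY0 mulmx0 subr0. Qed.

Lemma null_proj_idem : U *m U = U.
Proof. exact/null_proj_id/mulmx_null_proj. Qed.

(** A symmetric idempotent satisfies the Penrose equations with itself. *)
Lemma mpinv_null_proj : mpinv U = U.
Proof.
apply: penrose_unique (mpinvP U) _.
by rewrite /penrose !null_proj_idem tr_null_proj !eqxx.
Qed.

Lemma null_proj_orthogonal : is_orthogonal_projection U (nullspace C).
Proof.
move=> x; split=> [|y Cy0].
  by rewrite /nullspace mulmxA mulmx_null_proj mul0mx.
(* [U] fixes [y] and is symmetric, so it can be moved onto
   [x - U x], which it kills. *)
rewrite -(null_proj_id Cy0) dot_mulmxl tr_null_proj.
by rewrite mulmxBr mulmxA null_proj_idem subrr dotC dot0l.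
Qed.

End NullProjection.

Lemma mulmx_mpinv_range (R : realType) (m n : nat) (C : 'M[R]_(m, n))
    (c : 'cV[R]_m) :
  (exists x, lin_constraint C c x = 0) -> C *m (mpinv C *m c) = c.
Proof.
case=> x /subr0_eq <-; have /and4P[/eqP CC _ _ _] := mpinvP C.
by rewrite !mulmxA CC.
Qed.

Theorem theorem4 (R : realType) (m n s : nat)
    (C : 'M[R]_(m, n)) (c : 'cV[R]_m)
    (z lambda : 'I_s -> 'cV[R]_n) (rho : R)
    (hs : (0 < s)%N) (hrho : 0 < rho)
    (hfeasible : exists x : 'cV[R]_n, lin_constraint C c x = 0) :
  let d : 'cV[R]_n := s%:R^-1 *: \sum_(i < s) (z i - rho^-1 *: lambda i) in
  let U : 'M[R]_n := 1%:M - mpinv C *m C in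
  is_orthogonal_projection U (nullspace C) /\
  forall xstar : 'cV[R]_n,
    is_solution (objective z lambda rho) (lin_constraint C c) xstar <->
    xstar = mpinv C *m c + U *m mpinv U *m (d - mpinv C *m c).
Proof.
move=> d U; have Uproj : is_orthogonal_projection U (nullspace C).
  exact: null_proj_orthogonal.
split=> // y; rewrite mpinv_null_proj null_proj_idem -/U.
set v := d - _; set x := _ + _.
have Cx : C *m x = c.
  by rewrite mulmxDr mulmx_mpinv_range // mulmxA mulmx_null_proj mul0mx addr0.
apply: (nearest_point_unique (k := rho / 2 * s%:R) (d := d)
          (b := objective z lambda rho d)).
- by rewrite !mulr_gt0 ?invr_gt0 ?ltr0n.
- by move=> w; exact: objective_square.
- by rewrite /lin_constraint Cx subrr.
- move=> w /subr0_eq Cw; have -> : d - x = v - U *m v by rewrite /x opprD addrA.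
  by apply: (Uproj v).2; rewrite /nullspace mulmxBr Cx Cw subrr.
Qed.
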